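(* Let $A\in\mathbb{M}_d$. Then there exists a contraction $C\in\mathbb{M}_d$ such that $$A=\sqrt{2}\,|A|_{\mathrm{qsym}}^{1/2}\,C\,|A|_{\mathrm{qsym}}^{1/2}.$$
   Context: $d\ge 1$ is an integer and $\mathbb{M}_d$ is the space of complex $d\times d$ matrices. For $A\in\mathbb{M}_d$, $|A|=(A^*A)^{1/2}$, so $|A^*|=(AA^* )^{1/2}$. The quadratic symmetric modulus of $A$ is the positive semidefinite matrix $$|A|_{\mathrm{qsym}}:=\sqrt{\frac{|A|^2+|A^*|^2}{2}}.$$ Powers of positive semidefinite matrices are taken by functional calculus. A contraction is a matrix $C$ with operator norm $\|C\|_\infty\le 1$. *)

(* Defs.v *)
From HB Require Import structures.
From mathcomp Require Import all_boot all_order all_algebra.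
From mathcomp Require Import complex.
From mathcomp Require Import all_classical all_reals.
Set Implicit Arguments.
Unset Strict Implicit.
Unset Printing Implicit Defensive.
Import Order.TTheory GRing.Theory Num.Theory.
Local Open Scope classical_set_scope.
Local Open Scope ring_scope.
Local Open Scope complex_scope.
Local Open Scope sesquilinear_scope.

(* [H = U^-1 *m diag_mx s *m U], with [U := spectralmx H] unitary and
   [s := spectral_diag H], whenever [H] is normal; [s] is real when [H] is
   Hermitian, so taking real parts loses nothing there. The definition is only
   meaningful for Hermitian [H] (for non-normal [H], [U] and [s] are junk). *)
Definition mx_fun (R : realType) (d : nat) (f : R -> R) (H : 'M[R[i]]_d) :
    'M[R[i]]_d :=
  invmx (spectralmx H)
    *m diag_mx (map_mx (fun z : R[i] => (f (complex.Re z))%:C) (spectral_diag H))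
    *m spectralmx H.

Definition mx_sqrt (R : realType) (d : nat) (H : 'M[R[i]]_d) : 'M[R[i]]_d :=
  mx_fun Num.sqrt H.

Definition mx_abs (R : realType) (d : nat) (A : 'M[R[i]]_d) : 'M[R[i]]_d :=
  mx_sqrt (A ^t* *m A).

Definition mx_qsym (R : realType) (d : nat) (A : 'M[R[i]]_d) : 'M[R[i]]_d :=
  mx_sqrt (2^-1 *: (mx_abs A ^+ 2 + mx_abs (A ^t*) ^+ 2)).

Definition cV_norm2 (R : realType) (d : nat) (x : 'cV[R[i]]_d) : R :=
  Num.sqrt (\sum_(i < d) ComplexField.Normc.normc (x i 0) ^+ 2).

(* The set is bounded and contains 0, so [sup] is a genuine supremum. *)
Definition mx_opnorm (R : realType) (d : nat) (A : 'M[R[i]]_d) : R :=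
  sup [set cV_norm2 (A *m x) | x in [set x : 'cV[R[i]]_d | cV_norm2 x <= 1]].

Definition contraction (R : realType) (d : nat) (A : 'M[R[i]]_d) : Prop :=
  mx_opnorm A <= 1.

(* Main.v *)
(* Write Q = |A|_qsym, S = Q^(1/2), T the Moore-Penrose inverse of S, r = sqrt 2,
   and C = r^-1 T A T. As |Ax|^2 + |A*x|^2 = r^2 |Qx|^2, both A and A* vanish on
   ker Q, whence A = r S C S. For contractivity, let C*C u = l u and w = C u.
   Then A T u = r S w and A* T w = r l S u; since Q T = S, the bounds
   |Ax| <= r |Qx| at x = T u and |A*y| <= r |Qy| at y = T w give
   |S w| <= |S u| and l |S u| <= |S w|, so l <= 1. This replaces the usual
   argument by polar decomposition and operator monotonicity of the square root. *)
Require Import Defs.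
From mathcomp Require Import all_boot all_order all_algebra.
From mathcomp Require Import complex.
From mathcomp Require Import all_classical all_reals.
Local Open Scope ring_scope.
Local Open Scope complex_scope.
Set Implicit Arguments.
Unset Strict Implicit.
Unset Printing Implicit Defensive.
Import Order.TTheory GRing.Theory Num.Theory.
Local Open Scope sesquilinear_scope.

(** * Adjoints, squared norms, positive semidefinite matrices and unitary diagonalisation *)

Section Adjoint.
Context {K : numClosedFieldType}.

Lemma trmxC_mul m n p (A : 'M[K]_(m, n)) (B : 'M[K]_(n, p)) :
  (A *m B) ^t* = B ^t* *m A ^t*.
Proof. by rewrite trmx_mul map_mxM. Qed.

Lemma hermsymmx_trmxC n (H : 'M[K]_n) : H ^t* = H -> H \is hermsymmx.
Proof. by move=> hH; rewrite is_hermitianmxE expr0 scale1r hH. Qed.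

(** The squared Euclidean norm, kept in [K]: no square root is needed, and adjoints move across the
    product directly. *)
Definition normsq {n} (x : 'cV[K]_n) : K := (x ^t* *m x) 0 0.

Lemma normsqE n (x : 'cV[K]_n) : normsq x = \sum_i `|x i 0| ^+ 2.
Proof. by rewrite /normsq !mxE; apply: eq_bigr => i _; rewrite !mxE normCKC. Qed.

Lemma normsq_ge0 n (x : 'cV[K]_n) : 0 <= normsq x.
Proof. by rewrite normsqE sumr_ge0 // => i _; rewrite exprn_ge0. Qed.

Lemma normsq_eq0 n (x : 'cV[K]_n) : normsq x = 0 -> x = 0.
Proof.
rewrite normsqE => /eqP; rewrite psumr_eq0 => [/allP x0|i _]; last first.
  by rewrite exprn_ge0.
apply/matrixP => i j; rewrite ord1 mxE.
by have := x0 i (mem_index_enum i); rewrite expf_eq0 normr_eq0 => /eqP.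
Qed.

Lemma normsqZ n a (x : 'cV[K]_n) : normsq (a *: x) = `|a| ^+ 2 * normsq x.
Proof.
by rewrite !normsqE mulr_sumr; apply: eq_bigr => i _; rewrite mxE normrM exprMn.
Qed.

Lemma normsq_mul m n (A : 'M[K]_(m, n)) (x : 'cV[K]_n) :
  normsq (A *m x) = (x ^t* *m (A ^t* *m A) *m x) 0 0.
Proof. by rewrite /normsq trmxC_mul !mulmxA. Qed.

Lemma normsq_unitary n (U : 'M[K]_n) (x : 'cV[K]_n) :
  U \is unitarymx -> normsq (U *m x) = normsq x.
Proof.
by move=> hU; rewrite normsq_mul -invmx_unitary// mulVmx ?unitarymx_unit// mulmx1.
Qed.

Lemma mulmx_cV_eq0 m n (A : 'M[K]_(m, n)) :
  (forall x : 'cV_n, A *m x = 0) -> A = 0.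
Proof.
move=> A0; apply/matrixP => i j.
have := congr1 (fun M : 'cV_m => M i 0) (A0 (delta_mx j 0)).
by rewrite -colE !mxE.
Qed.

Definition psdmx {n} (H : 'M[K]_n) : Prop :=
  H ^t* = H /\ forall x : 'cV_n, 0 <= (x ^t* *m H *m x) 0 0.

Lemma psdmx_gram m n (A : 'M[K]_(m, n)) : psdmx (A ^t* *m A).
Proof.
split; first by rewrite trmxC_mul trmxCK.
by move=> x; rewrite -normsq_mul normsq_ge0.
Qed.

Lemma psdmxD n (G H : 'M[K]_n) : psdmx G -> psdmx H -> psdmx (G + H).
Proof.
move=> [hG G0] [hH H0]; split; first by rewrite linearD map_mxD hG hH.
by move=> x; rewrite mulmxDr mulmxDl mxE addr_ge0.
Qed.

Lemma psdmxZ n (a : K) (H : 'M[K]_n) : 0 <= a -> psdmx H -> psdmx (a *: H).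
Proof.
move=> a0 [hH H0]; split.
  rewrite linearZ /= map_mxZ hH; congr (_ *: _).
  exact/CrealP/ger0_real.
by move=> x; rewrite -scalemxAr -scalemxAl mxE mulr_ge0.
Qed.

(** Uses the adjoint where [mx_fun] has [invmx]; the two agree for unitary [U], and the adjoint
    makes Hermitian symmetry and the quadratic form computable for every [U]. *)
Definition conj_diag n (U : 'M[K]_n) (s : 'rV[K]_n) : 'M[K]_n :=
  U ^t* *m diag_mx s *m U.

Lemma conj_diag_form n (U : 'M[K]_n) (s : 'rV[K]_n) (x : 'cV[K]_n) :
  (x ^t* *m conj_diag U s *m x) 0 0 = \sum_i s 0 i * `|(U *m x) i 0| ^+ 2.
Proof.
rewrite !mulmxA -trmxC_mul -[_ *m U *m x]mulmxA mul_mx_diag mxE.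
by apply: eq_bigr => i _; rewrite !mxE normCKC mulrAC mulrC.
Qed.

Lemma conj_diagM n (U : 'M[K]_n) (s t : 'rV[K]_n) : U \is unitarymx ->
  conj_diag U s *m conj_diag U t = conj_diag U (\row_i (s 0 i * t 0 i)).
Proof.
move=> hU; rewrite /conj_diag -invmx_unitary// !mulmxA mulmxK ?unitarymx_unit//.
by rewrite -[_ *m diag_mx s *m _]mulmxA mulmx_diag.
Qed.

Lemma conj_diag_trmxC n (U : 'M[K]_n) (s : 'rV[K]_n) :
  s \is a realmx -> (conj_diag U s) ^t* = conj_diag U s.
Proof.
move=> hs; rewrite !trmxC_mul trmxCK mulmxA; congr (_ *m _ *m _).
by rewrite tr_diag_mx map_diag_mx realmxC.
Qed.

Lemma conj_diag_psdmx n (U : 'M[K]_n) (s : 'rV[K]_n) :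
  (forall i, 0 <= s 0 i) -> psdmx (conj_diag U s).
Proof.
move=> s0; split.
  by apply/conj_diag_trmxC/mxOverP => i j; rewrite ord1 ger0_real.
by move=> x; rewrite conj_diag_form sumr_ge0 // => i _; rewrite mulr_ge0 ?exprn_ge0.
Qed.

Lemma spectralE n (H : 'M[K]_n) :
  H ^t* = H -> H = conj_diag (spectralmx H) (spectral_diag H).
Proof.
move=> hH; rewrite /conj_diag -invmx_unitary ?spectral_unitarymx//.
exact/orthomx_spectralP/hermitian_normalmx/hermsymmx_trmxC.
Qed.

Lemma spectral_eigenvector n (H : 'M[K]_n) i : H ^t* = H ->
  exists u : 'cV_n, normsq u = 1 /\ H *m u = spectral_diag H 0 i *: u.
Proof.
move=> hH; set U := spectralmx H.
have hU : U \is unitarymx by exact: spectral_unitarymx.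
(* As [H] is [U ^t* *m D *m U] with [D] diagonal, the columns of [U ^t*] form an orthonormal
   eigenbasis. *)
exists (U ^t* *m delta_mx i 0); split.
  rewrite normsq_unitary ?trmxC_unitary// normsqE (bigD1 i)//= big1.
    by rewrite mxE !eqxx normr1 expr1n addr0.
  by move=> j /negPf ji; rewrite mxE ji normr0 expr0n.
rewrite [X in X *m _](spectralE hH) -/U -mulmxA [U *m _]mulmxA.
rewrite -invmx_unitary// mulmxV ?unitarymx_unit// mul1mx -mulmxA.
rewrite scalemxAr; congr (_ *m _); apply/matrixP => j k.
by rewrite mul_diag_mx !mxE; case: eqP => [->|]; rewrite //= !mulr0.
Qed.

(** At a unit eigenvector the quadratic form takes the eigenvalue itself. *)
Lemma spectral_diag_ge0 n (H : 'M[K]_n) i :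
  psdmx H -> 0 <= spectral_diag H 0 i.
Proof.
move=> [hH H0]; have [u [u1 hu]] := spectral_eigenvector i hH.
by have := H0 u; rewrite -mulmxA hu -scalemxAr mxE -/(normsq u) u1 mulr1.
Qed.

(** In the coordinates of an orthonormal eigenbasis of [C ^t* *m C], the left side is the sum on the
    right with each term multiplied by an eigenvalue. *)
Lemma normsq_mul_le n (C : 'M[K]_n) :
  (forall (u : 'cV_n) l, u != 0 -> 0 <= l -> C ^t* *m (C *m u) = l *: u -> l <= 1) ->
  forall x, normsq (C *m x) <= normsq x.
Proof.
move=> hC x; have [hH _] := psdmx_gram C.
rewrite normsq_mul (spectralE hH) conj_diag_form.
rewrite -(normsq_unitary x (spectral_unitarymx (C ^t* *m C))) normsqE.
apply: ler_sum => i _; rewrite ler_piMl ?exprn_ge0//.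
have [u [u1 hu]] := spectral_eigenvector i hH.
apply: (hC u); [|exact/spectral_diag_ge0/psdmx_gram|by rewrite mulmxA].
apply: contra_eq_neq u1 => ->.
by rewrite /normsq mulmx0 mxE eq_sym oner_eq0.
Qed.

End Adjoint.

(** * Functional calculus, the quadratic symmetric modulus and the operator norm *)

Section FunctionalCalculus.
Context {R : realType} {d : nat}.
Implicit Types (H : 'M[R[i]]_d) (f g : R -> R).

Definition spectral_map f H : 'rV[R[i]]_d :=
  \row_i (f (complex.Re (spectral_diag H 0 i)))%:C.

Lemma mx_funE f H : mx_fun f H = conj_diag (spectralmx H) (spectral_map f H).
Proof.
rewrite /conj_diag -(invmx_unitary (spectral_unitarymx H)).
suff -> : spectral_map f H =
    map_mx (fun z : R[i] => (f (complex.Re z))%:C) (spectral_diag H) by [].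
by apply/rowP => i; rewrite !mxE.
Qed.

(** Agreement on the spectrum is enough, so identities valid only for nonnegative reals, such as
    squaring a square root, can be used on positive matrices. *)
Lemma eq_mx_fun f g H :
  (forall i, f (complex.Re (spectral_diag H 0 i))
             = g (complex.Re (spectral_diag H 0 i))) ->
  mx_fun f H = mx_fun g H.
Proof.
move=> fg; rewrite !mx_funE.
suff -> : spectral_map f H = spectral_map g H by [].
by apply/rowP => i; rewrite !mxE fg.
Qed.

Lemma mx_funM f g H : mx_fun f H *m mx_fun g H = mx_fun (f \* g) H.
Proof.
rewrite !mx_funE (conj_diagM _ _ (spectral_unitarymx H)).
set s := \row_i _; suff -> : s = spectral_map (f \* g) H by [].
by apply/rowP => i; rewrite !mxE rmorphM.
Qed.

Lemma mx_fun_trmxC f H : (mx_fun f H) ^t* = mx_fun f H.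
Proof.
rewrite mx_funE conj_diag_trmxC//; apply/mxOverP => i j.
by rewrite mxE; apply/complex_realP; eexists.
Qed.

Lemma mx_fun_psdmx f H : (forall x, 0 <= f x) -> psdmx (mx_fun f H).
Proof.
by move=> f0; rewrite mx_funE; apply: conj_diag_psdmx => i; rewrite mxE lecR.
Qed.

(** Nonnegative elements of [R[i]] are real, so the real part taken in [mx_fun] leaves these
    eigenvalues unchanged. *)
Lemma mx_fun_id H : psdmx H -> mx_fun id H = H.
Proof.
move=> pH; rewrite [RHS](spectralE pH.1) mx_funE.
suff -> : spectral_map id H = spectral_diag H by [].
apply/rowP => i; rewrite mxE.
by rewrite RRe_real // ger0_real // spectral_diag_ge0.
Qed.

Lemma Re_spectral_diag_ge0 H i :
  psdmx H -> 0 <= complex.Re (spectral_diag H 0 i).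
Proof. by move/(spectral_diag_ge0 i); rewrite lecE => /andP[]. Qed.

Lemma mx_sqrt_psdmx H : psdmx (mx_sqrt H).
Proof. exact/mx_fun_psdmx/sqrtr_ge0. Qed.

Lemma mx_sqrtK H : psdmx H -> mx_sqrt H *m mx_sqrt H = H.
Proof.
move=> pH; rewrite mx_funM -[RHS](mx_fun_id pH); apply: eq_mx_fun => i /=.
by rewrite -expr2 sqr_sqrtr ?Re_spectral_diag_ge0.
Qed.

(* [T] is the Moore-Penrose inverse of [S] thanks to the convention [0^-1 = 0]. *)
Lemma mx_fun_pinv f H :
  let S := mx_fun f H in let T := mx_fun (fun x => (f x)^-1) H in
  [/\ T ^t* = T, S *m T = T *m S, T *m S *m T = T & S *m T *m S = S].
Proof.
move=> S T; split; first exact: mx_fun_trmxC.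
- apply: etrans (mx_funM _ _ _) (etrans _ (esym (mx_funM _ _ _))).
  by apply: eq_mx_fun => i; exact: mulrC.
- rewrite /S /T !mx_funM; apply: eq_mx_fun => i /=.
  by have [->|f0] := eqVneq (f (complex.Re (spectral_diag H 0 i))) 0;
    rewrite ?invr0 ?mulr0// mulVf// mul1r.
- rewrite /S /T !mx_funM; apply: eq_mx_fun => i /=.
  by have [->|f0] := eqVneq (f (complex.Re (spectral_diag H 0 i))) 0;
    rewrite ?mulr0// mulfV// mul1r.
Qed.

Lemma mx_abs_sq (A : 'M[R[i]]_d) : mx_abs A ^+ 2 = A ^t* *m A.
Proof. by rewrite expr2 [LHS]mx_sqrtK//; apply: psdmx_gram. Qed.

(** All the square roots cancel. Besides positivity, this is all that the factorization uses about
    [mx_qsym]. *)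
Lemma mx_qsym_sq (A : 'M[R[i]]_d) :
  mx_qsym A *m mx_qsym A = 2^-1 *: (A ^t* *m A + A *m A ^t*).
Proof.
have -> : mx_qsym A = mx_sqrt (2^-1 *: (A ^t* *m A + A *m A ^t*)).
  by rewrite /mx_qsym !mx_abs_sq trmxCK.
rewrite mx_sqrtK//; apply: psdmxZ; first by rewrite invr_ge0.
apply: psdmxD; first exact: psdmx_gram.
by rewrite -{1}[A]trmxCK; apply: psdmx_gram.
Qed.

Lemma normsq_cV_norm2 (x : 'cV[R[i]]_d) : normsq x = (cV_norm2 x ^+ 2)%:C.
Proof.
rewrite normsqE /cV_norm2 sqr_sqrtr; last first.
  by apply: sumr_ge0 => i _; exact: sqr_ge0.
by rewrite rmorph_sum; apply: eq_bigr => i _; rewrite rmorphXn.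
Qed.

Lemma contraction_normsq (C : 'M[R[i]]_d) :
  (forall x, normsq (C *m x) <= normsq x) -> contraction C.
Proof.
move=> hC; apply: ge_sup.
  (* Bounding a [sup] from above requires a nonempty set; the zero vector supplies a point. *)
  exists (cV_norm2 (C *m 0)), 0 => //=.
  rewrite /cV_norm2 big1 ?sqrtr0// => i _.
  by rewrite mxE ComplexField.Normc.normc0 expr0n.
move=> _ [x /= x1 <-]; apply: le_trans x1.
have := hC x; rewrite !normsq_cV_norm2 lecR ler_sqr ?nnegrE//; exact: sqrtr_ge0.
Qed.

End FunctionalCalculus.

(** * The factorization through [S] and the contractivity of its middle factor *)

Section QsymFactorization.
Context {K : numClosedFieldType} {n : nat}.
(** Functional calculus enters only through the algebraic identities assumed here. *)
Variables (r : K) (A Q S T : 'M[K]_n).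
Hypotheses (r_gt0 : 0 < r) (r2 : r ^+ 2 = 2) (QE : S *m S = Q).
Hypotheses (Sh : S ^t* = S) (Th : T ^t* = T).
Hypotheses (STC : S *m T = T *m S) (TST : T *m S *m T = T) (STS : S *m T *m S = S).
Hypothesis QQ : Q *m Q = 2^-1 *: (A ^t* *m A + A *m A ^t*).

(** This is [QQ] read as an identity of quadratic forms, with [r ^+ 2 = 2] absorbing the factor one
    half. *)
Let normsqQ (x : 'cV_n) :
  r ^+ 2 * normsq (Q *m x) = normsq (A *m x) + normsq (A ^t* *m x).
Proof.
have Qh : Q ^t* = Q by rewrite -QE trmxC_mul Sh.
rewrite !normsq_mul Qh QQ -scalemxAr -scalemxAl mxE r2 mulVKf ?pnatr_eq0//.
by rewrite trmxCK mulmxDr mulmxDl mxE.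
Qed.

Let leA (x : 'cV_n) : normsq (A *m x) <= r ^+ 2 * normsq (Q *m x).
Proof. by rewrite normsqQ lerDl normsq_ge0. Qed.

Let leAh (x : 'cV_n) : normsq (A ^t* *m x) <= r ^+ 2 * normsq (Q *m x).
Proof. by rewrite normsqQ lerDr normsq_ge0. Qed.

(** [T *m S] is the orthogonal projection with the same kernel as [S]. Since [Q *m (1 - T *m S) = S
    *m (S - S *m T *m S) = 0], the bound forces [B] to vanish on the range of [1 - T *m S]. *)
Let mulmx_proj (B : 'M[K]_n) :
  (forall x : 'cV_n, normsq (B *m x) <= r ^+ 2 * normsq (Q *m x)) ->
  B *m (T *m S) = B.
Proof.
move=> leB; apply/eqP; rewrite eq_sym -subr_eq0 -{1}[B]mulmx1 -mulmxBr; apply/eqP.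
apply: mulmx_cV_eq0 => x; apply: normsq_eq0; apply/eqP.
rewrite eq_le normsq_ge0 andbT -mulmxA; apply: le_trans (leB _) _.
rewrite mulmxA mulmxBr mulmx1 -QE mulmxA -[S *m S *m T]mulmxA STC mulmxA STS.
by rewrite subrr mul0mx /normsq mulmx0 mxE mulr0.
Qed.

Let AE : A *m (T *m S) = A. Proof. exact: mulmx_proj. Qed.

(** The adjoint of the projection identity for [A ^t*]. *)
Let EA : S *m T *m A = A.
Proof.
by rewrite -[RHS]trmxCK -[in RHS](mulmx_proj leAh) !trmxC_mul Sh Th trmxCK.
Qed.

Let C := r^-1 *: (T *m A *m T).

Let factorization : A = r *: (S *m C *m S).
Proof.
rewrite -scalemxAr -scalemxAl scalerA divff ?gt_eqF// scale1r.
by rewrite !mulmxA EA -mulmxA AE.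
Qed.

Let factor_contractive x : normsq (C *m x) <= normsq x.
Proof.
move: x; apply: normsq_mul_le => u l u0 l0 hl; set w := C *m u.
have QT : Q *m T = S by rewrite -QE -mulmxA STC mulmxA STS.
have Ch : C ^t* = r^-1 *: (T *m A ^t* *m T).
  rewrite linearZ /= map_mxZ !trmxC_mul Th mulmxA; congr (_ *: _).
  by apply/CrealP; rewrite realV gtr0_real.
have EAh : S *m T *m A ^t* = A ^t*.
  by rewrite -{2}AE trmxC_mul trmxC_mul Sh Th.
have SC : S *m C = r^-1 *: (A *m T) by rewrite -scalemxAr !mulmxA EA.
have SCh : S *m C ^t* = r^-1 *: (A ^t* *m T) by rewrite Ch -scalemxAr !mulmxA EAh.
have hSw : normsq (S *m w) <= normsq (S *m u).
  have le1 : normsq (A *m T *m u) <= r ^+ 2 * normsq (S *m u).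
    by have := leA (T *m u); rewrite !mulmxA QT.
  rewrite /w mulmxA SC -scalemxAl normsqZ ger0_norm ?invr_ge0 ?(ltW r_gt0)//.
  by rewrite exprVn ler_pdivrMl ?exprn_gt0.
have hSu : l ^+ 2 * normsq (S *m u) <= normsq (S *m w).
  have le1 : normsq (A ^t* *m T *m w) <= r ^+ 2 * normsq (S *m w).
    by have := leAh (T *m w); rewrite !mulmxA QT.
  rewrite -(ger0_norm l0) -normsqZ scalemxAr -hl -/w mulmxA SCh -scalemxAl.
  rewrite normsqZ ger0_norm ?invr_ge0 ?(ltW r_gt0)//.
  by rewrite exprVn ler_pdivrMl ?exprn_gt0.
(* The norm of [S *m u] can be cancelled only when nonzero. If [S *m u = 0], then
   [T *m u = T *m T *m S *m u = 0], so [w = 0] and [l *: u = 0], whence [l = 0]. *)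
have [Su0|Su0] := eqVneq (S *m u) 0.
  have w0 : w = 0.
    by rewrite /w -scalemxAl -TST -[T *m S *m T]mulmxA STC -!mulmxA Su0 !mulmx0 scaler0.
  move: hl; rewrite -/w w0 mulmx0 => /esym/eqP.
  by rewrite scaler_eq0 (negPf u0) orbF => /eqP ->; exact: ler01.
have Su_gt0 : 0 < normsq (S *m u).
  by rewrite lt_def normsq_ge0 andbT; apply: contra_neq Su0 => /normsq_eq0.
(* The bounds concern squared norms, so they chain to [l ^+ 2 <= 1], which suffices because
   [0 <= l]. *)
rewrite -(@expr_le1 _ 2)// -(ler_pM2r Su_gt0) mul1r.
exact: le_trans hSu hSw.
Qed.

Lemma qsym_factorization : exists C : 'M[K]_n,
  (forall x : 'cV_n, normsq (C *m x) <= normsq x) /\ A = r *: (S *m C *m S).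
Proof. by exists C. Qed.

End QsymFactorization.

Theorem lemma2p1 (R : realType) (d : nat) (hd : (1 <= d)%N) (A : 'M[R[i]]_d) :
  exists C : 'M[R[i]]_d,
    contraction C /\
    A = (Num.sqrt (2 : R))%:C *: (mx_sqrt (mx_qsym A) *m C *m mx_sqrt (mx_qsym A)).
Proof.
set Q := mx_qsym A; set S := mx_sqrt Q.
(* Here [T] is the function [(Num.sqrt x)^-1] applied to [Q]. *)
have [Th STC TST STS] := mx_fun_pinv Num.sqrt Q.
have r_gt0 : 0 < (Num.sqrt (2 : R))%:C by rewrite ltcR sqrtr_gt0.
have r2 : (Num.sqrt (2 : R))%:C ^+ 2 = 2.
  have s2 : Num.sqrt (2 : R) ^+ 2 = 2 by rewrite sqr_sqrtr ?ler0n.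
  rewrite -(rmorphXn (real_complex R)) s2.
  exact: (rmorph_nat (real_complex R)).
have QE : S *m S = Q by exact/mx_sqrtK/mx_sqrt_psdmx.
have [Sh _] : psdmx S by exact: mx_sqrt_psdmx.
have [C [leC AE]] :=
  qsym_factorization r_gt0 r2 QE Sh Th STC TST STS (mx_qsym_sq A).
by exists C; split; first exact: contraction_normsq.
Qed.
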